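(* Let $r>0$ be an integer and let $L\subset\mathbb{P}^n$ be a linear space of dimension $k$. Let $s$ be the number of coloops and $t$ the number of components of the associated linear matroid $\mathcal{M}_L$. Then $$\deg L^{\circ r} = r^{\,k+s-t+1}.$$
   Context: We work over $\mathbb{C}$. $L^{\circ r}$ denotes the $r$-th coordinate-wise power of $L$: the image of $L$ under the morphism $\varphi_r\colon\mathbb{P}^n\to\mathbb{P}^n$, $[x_0:\ldots:x_n]\mapsto[x_0^r:\ldots:x_n^r]$. The linear matroid of $L$, on the ground set $\{0,1,\ldots,n\}$, is given by the following collection of independent sets (the convention is fixed as follows; some authors use the dual one): $$\mathcal{M}_L := \{I\subset\{0,1,\ldots,n\}\mid L\cap V(\{x_i\mid i\notin I\})=\emptyset\}.$$ An index $i\in\{0,\ldots,n\}$ is a coloop of $\mathcal{M}_L$ if for all $I\subset\{0,\ldots,n\}$ one has $I\in\mathcal{M}_L$ if and only if $I\cup\{i\}\in\mathcal{M}_L$ (equivalently, $L\subset V(x_i)$). A subset $E\subset\{0,\ldots,n\}$ is irreducible if there is no non-trivial partition $E=E_1\sqcup E_2$ (both parts non-empty) such that for all $I\subset E$: $I\in\mathcal{M}_L$ if and only if $I\cap E_1\in\mathcal{M}_L$ and $I\cap E_2\in\mathcal{M}_L$. The components of $\mathcal{M}_L$ are the maximal irreducible subsets of $\{0,\ldots,n\}$; they form a partition of $\{0,\ldots,n\}$. *)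

(* Defs.v *)
From HB Require Import structures.
From mathcomp Require Import all_boot all_order all_algebra.
From mathcomp Require Import boolp classical_sets reals.
From mathcomp Require Import complex mpoly.

Set Implicit Arguments.
Unset Strict Implicit.
Unset Printing Implicit Defensive.

Import Order.TTheory GRing.Theory Num.Theory.
Local Open Scope ring_scope.

(* A point of P^n is a line through the origin of F^(n+1). *)
Definition projspace (F : fieldType) (n : nat) :=
  {P : {vspace 'rV[F]_n.+1} | \dim P == 1}.

Section ProjectiveSpace.
Variables (F : fieldType) (n : nat).
Local Notation V := 'rV[F]_n.+1.
Local Notation PP := (projspace F n).
Implicit Types (P Q : PP) (X L : set PP).

Definition proj_point (x : V) (x_neq0 : x != 0) : PP :=
  exist _ <[x]>%VS (introT eqP (etrans (dim_vline x) (congr1 nat_of_bool x_neq0))).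

Definition homog_coords P : V := vpick (sval P).

Lemma homog_coords_neq0 P : homog_coords P != 0.
Proof. by rewrite vpick0 -dimv_eq0 (eqP (svalP P)). Qed.

Definition coord_pow (r : nat) (x : V) : V := \row_i x 0 i ^+ r.

Lemma coord_pow_neq0 r x : x != 0 -> coord_pow r x != 0.
Proof.
move=> /rV0Pn[i xi]; apply/rV0Pn; exists i.
by rewrite mxE expf_neq0.
Qed.

Definition pow_map (r : nat) P : PP :=
  proj_point (coord_pow_neq0 r (homog_coords_neq0 P)).

(* The choice of homogeneous coordinates in [pow_map] is irrelevant. *)
Lemma pow_map_point r x (x0 : x != 0) :
  pow_map r (proj_point x0) = proj_point (coord_pow_neq0 r x0).
Proof.
apply: val_inj => /=; set y := homog_coords _.
have y0 : y != 0 := homog_coords_neq0 _.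
have /vlineP[c yE] : y \in <[x]>%VS by exact: memv_pick.
have c0 : c != 0 by apply: contraNneq y0 => c0; rewrite yE c0 scale0r.
have -> : coord_pow r y = c ^+ r *: coord_pow r x.
  by apply/rowP => i; rewrite !mxE yE mxE exprMn.
apply/eqP; rewrite eqEsubv -!memvE memvZ ?memv_line //=.
rewrite -[X in X \in _](scalerK (expf_neq0 r c0)).
by rewrite memvZ ?memv_line.
Qed.

Definition coord_power (r : nat) X : set PP := (pow_map r @` X)%classic.

Definition linear_space (k : nat) L : Prop :=
  exists2 W : {vspace V}, \dim W = k.+1
    & L = [set P : PP | (sval P <= W)%VS]%classic.

Definition coord_subspace (S : {set 'I_n.+1}) : set PP :=
  [set P : PP | forall x, x \in sval P -> forall i, i \in S -> x 0 i = 0]%classic.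

Definition vanishes (d : nat) (f : dhomog n.+1 F d) X : Prop :=
  forall P, X P -> forall x, x \in sval P -> (f : {mpoly F[n.+1]}).@[x 0] = 0.

(* The degree-d part of the homogeneous ideal I(X); it is characterised by
   [vanishing_formsP], so the default value 0 is never used. *)
Definition vanishing_forms X (d : nat) : {vspace dhomog n.+1 F d} :=
  xget 0%VS
    [set U : {vspace dhomog n.+1 F d}
      | forall f, f \in U <-> vanishes f X]%classic.

Lemma vanishing_formsP X d (f : dhomog n.+1 F d) :
  f \in vanishing_forms X d <-> vanishes f X.
Proof.
pose sub (U : {vspace dhomog n.+1 F d}) := forall f, f \in U -> vanishes f X.
pose good m := `[< exists2 U, sub U & \dim U = m >].
have ex_good : exists m, good m.
  exists 0%N; apply/asboolP; exists 0%VS; last by rewrite dimv0.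
  by move=> g /[!memv0] /eqP-> P _ x _; rewrite meval0.
have good_le m : good m -> (m <= \dim (fullv : {vspace dhomog n.+1 F d}))%N.
  by move=> /asboolP[U _ <-]; rewrite dimvS ?subvf.
have [m /asboolP[U subU dimU] max_m] := ex_maxnP ex_good good_le.
suff exU : exists U : {vspace dhomog n.+1 F d},
    forall g, g \in U <-> vanishes g X.
  exact: (xgetPex 0%VS exU).
exists U => g; split=> [|g0]; first exact: subU.
have subUg : sub (U + <[g]>)%VS.
  move=> _ /memv_addP[u uU [_ /vlineP[c ->] ->]] P XP x Px.
  change (((u : {mpoly F[n.+1]}) + c *: (g : {mpoly F[n.+1]})).@[x 0] = 0).
  by rewrite mevalD mevalZ (subU u uU P) // (g0 P) // mulr0 addr0.
have le_m := max_m _ (asboolT (ex_intro2 _ _ _ subUg erefl)).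
have /eqP UE : U == (U + <[g]>)%VS by rewrite eqEdim addvSl dimU.
by rewrite UE (subvP (addvSr U _)) ?memv_line.
Qed.

Definition hilbert_fun X (d : nat) : nat :=
  (\dim (fullv : {vspace dhomog n.+1 F d}) - \dim (vanishing_forms X d))%N.

(* The default value 0 would give degree 0, so a nonzero value of
   [proj_degree] entails that the Hilbert polynomial exists. *)
Definition hilbert_poly X : {poly rat} :=
  xget 0
    [set p : {poly rat} | exists d0 : nat, forall d : nat, (d0 <= d)%N ->
       (hilbert_fun X d)%:R = p.[d%:R]]%classic.

Lemma hilbert_poly_unique X (p : {poly rat}) (d0 : nat) :
  (forall d : nat, (d0 <= d)%N -> (hilbert_fun X d)%:R = p.[d%:R]) ->
  hilbert_poly X = p.
Proof.
move=> pE; apply: xget_unique => [|q [d1 qE]]; first by exists d0.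
apply/eqP; rewrite -subr_eq0; apply: contraT => qp_neq0.
pose s : seq rat := [seq i%:R | i <- iota (maxn d0 d1) (size (q - p))].
have root_s : all (root (q - p)) s.
  apply/allP => _ /mapP[d + ->]; rewrite mem_iota geq_max.
  move=> /andP[/andP[d0d d1d] _].
  by rewrite rootE hornerD hornerN -pE // -qE // subrr.
have uniq_s : uniq s.
  rewrite map_inj_uniq ?iota_uniq // => i j /eqP.
  by rewrite eqr_nat => /eqP.
by have := max_poly_roots qp_neq0 root_s uniq_s; rewrite size_map size_iota ltnn.
Qed.

(* (dim X)! times the leading coefficient of the Hilbert polynomial, whose
   degree is dim X. *)
Definition proj_degree X : rat :=
  (((size (hilbert_poly X)).-1)`!)%:R * lead_coef (hilbert_poly X).

(* The convention is the dual of the matroid of the coordinate forms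
   restricted to L. *)
Definition linear_matroid L : {set {set 'I_n.+1}} :=
  [set I : {set 'I_n.+1} |
     `[< (L `&` coord_subspace (~: I) = classical_sets.set0)%classic >]].

End ProjectiveSpace.

Section Matroid.
Variables (T : finType) (M : {set {set T}}).

Definition coloop (i : T) : bool :=
  [forall I : {set T}, (I \in M) == (i |: I \in M)].

Definition irreducible_set (E : {set T}) : bool :=
  ~~ [exists E1 : {set T}, exists E2 : {set T},
      [&& E1 != finset.set0, E2 != finset.set0, E1 :|: E2 == E,
          [disjoint E1 & E2] &
          [forall I : {set T}, (I \subset E) ==>
             ((I \in M) == ((I :&: E1 \in M) && (I :&: E2 \in M)))]]].

Definition coloops : {set T} := [set i | coloop i].

Definition components : {set {set T}} := [set E | maxset irreducible_set E].

End Matroid.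

(* Main.v *)
Require Import Defs.
From HB Require Import structures.
From mathcomp Require Import all_boot all_order all_algebra.
From mathcomp Require Import boolp classical_sets reals.
From mathcomp Require Import complex mpoly.
From mathcomp Require Import cyclic separable cyclotomic.
From mathcomp Require Import fintype finset ring lra zify.

(* Let [l_0, ..., l_n] be the coordinate forms restricted to the cone over [L],
   of dimension [k + 1], and take [k + 1] of them as coordinates [y]. The
   homogeneous coordinate ring of the [r]-th power of [L] is the algebra [A]
   generated by the [l_i^r], whose Hilbert function is eventually polynomial
   because the complement of a monomial ideal is counted by a polynomial.
   Join two coordinates when they occur in a common [l_i], let [c] be the
   number of connected classes of coordinates and put [N = r^(k + 1 - c)].
   - Monomials of elements of [A] have degree divisible by [r] in the
     variables of each class; counting them by exponents modulo [r] bounds the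
     Hilbert function by [N * 'C(d + k, k)].
   - Multiplying the coordinates by [r]-th roots of unity, modulo those
     constant on the classes, gives [N] distinct conjugates to a general
     [a = \sum_i c_i l_i^r]. Hence [1, a, ..., a^(N-1)] are linearly independent
     over the ring of polynomials in the [y_j^r], and the Hilbert function is
     at least [N * 'C(d - N + k, k)].
   So the degree is [N]. Finally the components of the matroid are the [s]
   coloops and [c] further ones, one for each class of coordinates. *)

Set Implicit Arguments.
Unset Strict Implicit.
Unset Printing Implicit Defensive.

Import Order.TTheory GRing.Theory Num.Theory.
Local Open Scope ring_scope.

(** * Eventually polynomial functions and up-closed sets of exponents *)

Definition eventually_poly (h : nat -> rat) : Prop :=
  exists (p : {poly rat}) (d0 : nat),
    forall d, (d0 <= d)%N -> h d = p.[d%:R].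

Lemma eventually_poly_sum (I : Type) (s : seq I) (h : I -> nat -> rat) :
  (forall i, eventually_poly (h i)) ->
  eventually_poly (fun d => \sum_(i <- s) h i d).
Proof.
move=> hP; elim: s => [|i s [p [d0 pE]]].
  by exists 0, 0%N => d _; rewrite big_nil horner0.
have [q [d1 qE]] := hP i; exists (q + p), (maxn d0 d1) => d.
by rewrite geq_max => /andP[d0d d1d]; rewrite big_cons hornerD qE // pE.
Qed.

Lemma eventually_poly_shift (h : nat -> rat) j :
  eventually_poly h -> eventually_poly (fun d => h (d - j)%N).
Proof.
move=> [p [d0 pE]]; exists (p \Po ('X - j%:R%:P)), (d0 + j)%N => d le_d.
rewrite horner_comp !hornerE -natrB ?pE //; lia.
Qed.

(** This is [m!] times the polynomial with values ['C(d + m, m)], scaled to be monic. *)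
Definition rising (m : nat) : {poly rat} := \prod_(i < m) ('X - (- i.+1%:R)%:P).

Lemma rising_monic m : rising m \is monic.
Proof. exact: monic_prod_XsubC. Qed.

Lemma size_rising m : size (rising m) = m.+1.
Proof.
by rewrite /rising -(big_mkord xpredT (fun i => 'X - (- i.+1%:R)%:P))
  size_prod_XsubC size_iota subn0.
Qed.

Lemma horner_rising m d : (rising m).[d%:R] = (m`! * 'C(d + m, m))%:R.
Proof.
rewrite mulnC bin_ffact; elim: m => [|m IHm].
  by rewrite /rising big_ord0 hornerC ffactn0.
rewrite /rising big_ord_recr hornerM -/(rising m) IHm addnS ffactSS natrM mulrC.
by rewrite hornerXsubC opprK -natrD addnS.
Qed.

Lemma sum_bin_diag m d : (\sum_(i < d.+1) 'C(i + m, m) = 'C(d + m.+1, m.+1))%N.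
Proof.
elim: d => [|d IHd]; first by rewrite big_ord_recr big_ord0 !binn.
by rewrite big_ord_recr /= IHd !addnS !addSn binS.
Qed.

(** Induction on the size: a multiple of [rising m] removes the leading term of [p], and by
    [sum_bin_diag] its partial sums are values of a multiple of [rising m.+1]. *)
Lemma sum_horner (p : {poly rat}) :
  exists q : {poly rat}, forall d, \sum_(i < d.+1) p.[i%:R] = q.[d%:R].
Proof.
have [n] := ubnP (size p); elim: n => // n IHn in p *; rewrite ltnS => le_p.
have [->|p0] := eqVneq p 0.
  by exists 0 => d; rewrite horner0 big1 // => i _; rewrite horner0.
pose m := (size p).-1; pose p' := p - lead_coef p *: rising m.
have size_p : size p = m.+1 by rewrite prednK ?lt0n ?size_poly_eq0.
have lt_p' : (size p' < size p)%N.
  have le_p' : (size p' <= m.+1)%N.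
    rewrite (leq_trans (size_polyD _ _)) // geq_max size_p leqnn size_polyN.
    by rewrite (leq_trans (size_scale_leq _ _)) ?size_rising.
  rewrite size_p ltnS; apply/leq_sizeP => j le_mj.
  have [lt_mj|le_jm] := ltnP m j.
    exact: (leq_sizeP _ _ le_p').
  have -> : j = m by apply/eqP; rewrite eqn_leq le_mj le_jm.
  have rm : (rising m)`_m = 1.
    by have /monicP := rising_monic m; rewrite lead_coefE size_rising.
  by rewrite coefB coefZ rm mulr1 lead_coefE subrr.
have [q' q'E] := IHn p' (leq_trans lt_p' le_p).
exists (q' + (lead_coef p * m`!%:R / (m.+1)`!%:R) *: rising m.+1) => d.
have pE x : p.[x] = p'.[x] + (lead_coef p *: rising m).[x].
  by rewrite -hornerD subrK.
rewrite hornerD -q'E; under eq_bigr do rewrite pE.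
rewrite big_split /=; congr (_ + _).
rewrite hornerZ horner_rising -sum_bin_diag.
under eq_bigr do rewrite hornerZ horner_rising natrM mulrA.
rewrite -mulr_sumr (natrM _ (m.+1)`!) natr_sum mulrA; congr (_ * _).
by rewrite mulfVK // pnatr_eq0 -lt0n fact_gt0.
Qed.

Lemma eventually_poly_psum (h : nat -> rat) :
  eventually_poly h -> eventually_poly (fun d => \sum_(i < d.+1) h i).
Proof.
move=> [p [d0 pE]]; have [q qE] := sum_horner p.
exists (q + (\sum_(i < d0) (h i - p.[i%:R]))%:P), d0 => d le_d.
rewrite hornerD hornerC -qE addrC; apply/eqP; rewrite -subr_eq -sumrB; apply/eqP.
rewrite -(big_mkord xpredT (fun i => h i - p.[i%:R])).
rewrite (@big_cat_nat _ _ _ d0) ?(leq_trans le_d) //=.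
rewrite [X in _ + X]big1_seq ?addr0 ?big_mkord // => i.
by rewrite mem_index_iota => /andP[_ /andP[le_i _]]; rewrite pE ?subrr.
Qed.

(** Exponent vectors are plain lists here, so that inductions on [n] can peel off the first
    exponent. *)
Fixpoint compositions (n d : nat) : seq (seq nat) :=
  if n is n'.+1 then
    flatten [seq [seq j :: m | m <- compositions n' (d - j)] | j <- iota 0 d.+1]
  else if d is 0 then [:: [::]] else [::].

Lemma compositionsS n d : compositions n.+1 d =
  flatten [seq [seq j :: m | m <- compositions n (d - j)] | j <- iota 0 d.+1].
Proof. by []. Qed.

Lemma mem_compositions n d m :
  (m \in compositions n d) = (size m == n) && (sumn m == d).
Proof.
elim: n => [|n IHn] in d m *; first by case: d => [|d]; case: m => [|[|x] m].
apply/flatten_mapP/andP => [[j]|].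
  rewrite mem_iota => /andP[_ lt_j] /mapP[m' + ->].
  by rewrite IHn => /andP[/eqP sm' /eqP m'd]; rewrite /= sm' m'd; split=> //; lia.
case: m => [[]|j m [/eqP[sm] /eqP jm]] //.
exists j; first by rewrite mem_iota /= in jm *; lia.
by apply/map_f; rewrite IHn sm eqxx /= in jm *; lia.
Qed.

Lemma compositions_uniq n d : uniq (compositions n d).
Proof.
elim: n => [|n IHn] in d *; first by case: d.
rewrite compositionsS.
apply: (@allpairs_uniq_dep _ (fun _ : nat => seq nat : eqType) _ (fun j => cons j)
  (iota 0 d.+1) (fun j => compositions n (d - j))) => //; first exact: iota_uniq.
by move=> [i x] [j y] _ _ /= [-> ->].
Qed.

Lemma count_compositionsS n d (p : pred (seq nat)) :
  count p (compositions n.+1 d) =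
  (\sum_(j < d.+1) count (fun m => p (nat_of_ord j :: m)) (compositions n (d - j)))%N.
Proof.
rewrite compositionsS count_flatten sumnE big_map big_map.
rewrite -[in RHS](big_mkord xpredT (fun j =>
  count (fun m => p (j :: m)) (compositions n (d - j)))) /index_iota subn0.
by apply: eq_bigr => j _; rewrite count_map.
Qed.

(** These are the exponent sets of monomial ideals in [n] variables. *)
Definition up_closed (n : nat) (U : pred (seq nat)) : Prop :=
  forall m m', size m = n -> all2 leq m m' -> U m -> U m'.

Lemma all2_leqnn (m : seq nat) : all2 leq m m.
Proof. by elim: m => //= x m ->; rewrite leqnn. Qed.

Lemma up_closed_cons n (U : pred (seq nat)) j :
  up_closed n.+1 U -> up_closed n (fun m => U (j :: m)).
Proof.
by move=> upU m m' sm mm'; apply: upU; rewrite /= ?sm ?leqnn.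
Qed.

(* Noetherianity of N^n: in the inductive step the diagonal of the doubly
   increasing family of slices stabilises, and beyond that stage only finitely
   many slices remain to be treated. *)
Lemma up_closed_chain_stable n (U : nat -> pred (seq nat)) :
    (forall j, up_closed n (U j)) ->
    (forall i j m, (i <= j)%N -> size m = n -> U i m -> U j m) ->
  exists j0, forall j m, (j0 <= j)%N -> size m = n -> U j m = U j0 m.
Proof.
elim: n => [|n IHn] in U * => upU incU.
  have [[j Uj]|noU] := pselect (exists j, U j [::]).
    by exists j => i m le_ji /size0nil->; rewrite Uj (incU _ _ _ le_ji).
  exists 0%N => i m _ /size0nil->.
  by apply/idP/idP => Ui; case: noU; [exists i|exists 0%N].
have inc2 i i' j j' m : (i <= i')%N -> (j <= j')%N -> size m = n ->
    U j (i :: m) -> U j' (i' :: m).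
  move=> ii' jj' sm Uj; apply: incU jj' _ _; rewrite /= ?sm //.
  by apply: upU Uj; rewrite /= ?sm // ii' all2_leqnn.
have [i0 diagU] : exists i0, forall j m, (i0 <= j)%N -> size m = n ->
    U j (j :: m) = U i0 (i0 :: m).
  apply: (IHn (fun j m => U j (j :: m))) => [j|i j m le_ij sm].
    exact: up_closed_cons (upU j).
  exact: inc2.
have [s sliceU] : exists s : nat -> nat, forall i j m, (s i <= j)%N ->
    size m = n -> U j (i :: m) = U (s i) (i :: m).
  suff /choice[s sP] : forall i, exists s, forall j m, (s <= j)%N ->
      size m = n -> U j (i :: m) = U s (i :: m) by exists s.
  move=> i.
  apply: (IHn (fun j m => U j (i :: m))) => [j|j j' m le_j sm].
    exact: up_closed_cons (upU j).
  exact: inc2.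
exists (maxn i0 (\max_(i < i0) s i)) => j [|i m] //; rewrite geq_max.
move=> /andP[le_i0 le_s] [sm]; have [lt_i|le_i] := ltnP i i0.
  have le_si : (s i <= \max_(i < i0) s i)%N.
    exact: (leq_bigmax (Ordinal lt_i)).
  rewrite (sliceU i j) ?(leq_trans le_si) // [RHS]sliceU //.
  by rewrite leq_max le_si orbT.
have stabU j' : (i0 <= j')%N -> U j' (i :: m) = U i0 (i0 :: m).
  move=> le_j'; apply/idP/idP; last exact: inc2.
  rewrite -(diagU (maxn i j')) ?leq_max ?le_i //.
  by apply: inc2; rewrite ?leq_max ?leqnn ?orbT.
by rewrite !stabU ?leq_max ?leqnn.
Qed.

(** Slice by the first exponent. The slices stabilise at some [j0], so the count is a finite sum of
    shifted slice counts plus a partial sum of the count for the slice [j0]. *)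
Lemma count_up_closedC n (U : pred (seq nat)) : up_closed n U ->
  eventually_poly (fun d => (count (predC U) (compositions n d))%:R).
Proof.
elim: n => [|n IHn] in U * => upU.
  by exists 0, 1%N => -[] // d _; rewrite horner0.
have [j0 stabU] : exists j0, forall j m, (j0 <= j)%N -> size m = n ->
    U (j :: m) = U (j0 :: m).
  apply: (@up_closed_chain_stable n (fun j m => U (j :: m))).
    by move=> j; apply: up_closed_cons.
  by move=> i j m le_ij sm; apply: upU; rewrite /= ?sm // le_ij all2_leqnn.
pose c j d : rat := (count (predC (fun m => U (j :: m))) (compositions n d))%:R.
have cP j : eventually_poly (c j) by apply/IHn/up_closed_cons.
(* Index 0 gathers all slices from [j0] on; index [j.+1] is the single slice [j]. *)
pose h i d : rat := if i is j.+1 then c j (d - j)%N else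
  \sum_(e < (d - j0).+1) c j0 e.
have hP i : eventually_poly (h i).
  case: i => [|i]; last exact: eventually_poly_shift.
  exact: (eventually_poly_shift (h := fun d => \sum_(e < d.+1) c j0 e) j0
            (eventually_poly_psum (cP j0))).
have [p [d0 pE]] := eventually_poly_sum (iota 0 j0.+1) hP.
exists p, (maxn d0 j0) => d; rewrite geq_max => /andP[d0d j0d].
rewrite -pE // count_compositionsS natr_sum.
rewrite -(big_mkord xpredT (fun j => c j (d - j)%N)).
rewrite (@big_cat_nat _ _ _ j0) ?(leq_trans j0d) //= big_cons [h 0%N d]/= addrC.
rewrite -(big_mkord xpredT (c j0)); congr (_ + _); last first.
  rewrite -[1%N]addn0 iotaDl big_map.
  by rewrite /index_iota subn0; apply: eq_bigr.
rewrite big_nat_rev /= -{1}[j0]add0n big_addn subSn //.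
apply: eq_big_nat => i /andP[_ lt_i].
rewrite (_ : d - _ = i)%N; last by lia.
rewrite /c; congr (_%:R); apply: eq_in_count => m.
by rewrite mem_compositions => /andP[/eqP sm _] /=; rewrite stabU //; lia.
Qed.

(** Once [d] times the absolute value of the leading coefficient exceeds the sum of those of the
    other coefficients, the leading term decides the sign. *)
Lemma eventually_ge0_lead_coef (p : {poly rat}) d0 :
  (forall d, (d0 <= d)%N -> 0 <= p.[d%:R]) -> 0 <= lead_coef p.
Proof.
move=> p_ge0; rewrite leNgt; apply/negP => lc_lt0.
pose m := (size p).-1; pose M := \sum_(i < m) `|p`_i|.
have p0 : p != 0 by rewrite -lead_coef_eq0 lt_eqF.
have size_p : size p = m.+1 by rewrite prednK ?lt0n ?size_poly_eq0.
pose D := Num.bound (M / `|lead_coef p|).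
pose d := (maxn d0 D.+1).
have d_gt0 : 0 < d%:R :> rat by rewrite ltr0n; lia.
have ltM : M < d%:R * - lead_coef p.
  rewrite -[- _]ltr0_norm // -ltr_pdivrMr ?normr_gt0 ?lead_coef_eq0 //.
  apply: (@lt_le_trans _ _ D%:R); last by rewrite ler_nat leq_max leqnSn orbT.
  by rewrite archi_boundP // divr_ge0 ?sumr_ge0.
suff : p.[d%:R] < 0 by rewrite ltNge p_ge0 // leq_maxl.
rewrite horner_coef size_p big_ord_recr /= -[p`_m]/(lead_coef p).
have le1 : \sum_(i < m) p`_i * d%:R ^+ i <= M * d%:R ^+ m.-1.
  rewrite mulr_suml; apply: ler_sum => i _.
  apply: le_trans (ler_norm _) _; rewrite normrM ler_wpM2l //.
  rewrite normrX (ger0_norm (ltW d_gt0)) ler_weXn2l //.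
    by rewrite ler1n -(ltr0n rat).
  by have := ltn_ord i; lia.
apply: (le_lt_trans (lerD le1 (lexx _))).
have [m0|m_gt0] := posnP m.
  by rewrite /M m0 big_ord0 mul0r add0r expr0 mulr1.
have -> : d%:R ^+ m = d%:R * d%:R ^+ m.-1 :> rat by rewrite -exprS prednK.
rewrite mulrA -mulrDl pmulr_llt0 ?exprn_gt0 //.
by move: ltM; rewrite mulrN mulrC; lra.
Qed.

(* Both bounds have the same leading term, so their difference has smaller
   size and bounds the deviation of [p] from the upper one. *)
Lemma rising_squeeze (p : {poly rat}) (m N d0 : nat) : (0 < N)%N ->
    (forall d, (d0 <= d)%N ->
       (N * 'C(d - N + m, m))%:R <= p.[d%:R] <= (N * 'C(d + m, m))%:R) ->
  size p = m.+1 /\ lead_coef p = N%:R / m`!%:R.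
Proof.
move=> N_gt0 p_bd; pose u : {poly rat} := (N%:R / m`!%:R) *: rising m.
have c_neq0 : N%:R / m`!%:R != 0 :> rat.
  by rewrite mulf_neq0 ?invr_eq0 ?pnatr_eq0 -?lt0n ?fact_gt0.
have size_u : size u = m.+1 by rewrite size_scale ?size_rising.
have lc_u : lead_coef u = N%:R / m`!%:R.
  by rewrite lead_coefZ (monicP (rising_monic m)) mulr1.
have uE d : u.[d%:R] = (N * 'C(d + m, m))%:R.
  by rewrite hornerZ horner_rising !natrM mulrA divfK ?pnatr_eq0 -?lt0n ?fact_gt0.
pose l := u \Po ('X - N%:R%:P).
have lE d : (N <= d)%N -> l.[d%:R] = (N * 'C(d - N + m, m))%:R.
  by move=> le_Nd; rewrite -uE horner_comp !hornerE natrB.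
have size_l : size l = m.+1 by rewrite size_comp_poly2 ?size_XsubC.
have lc_l : lead_coef l = lead_coef u.
  by rewrite lead_coef_comp ?size_XsubC // lead_coefXsubC expr1n mulr1.
have lc_ul : 0 <= lead_coef (u - p) /\ 0 <= lead_coef (p - l).
  split; apply: (@eventually_ge0_lead_coef _ (maxn d0 N)) => d; rewrite geq_max.
    move=> /andP[d0d Nd]; rewrite hornerD hornerN subr_ge0 uE.
    by case/andP: (p_bd d d0d).
  move=> /andP[d0d Nd]; rewrite hornerD hornerN subr_ge0 lE //.
  by case/andP: (p_bd d d0d).
have size_ul : (size (u - l)%R <= m)%N.
  apply/leq_sizeP => j le_mj; rewrite coefB.
  have [lt_mj|le_jm] := ltnP m j.
    by rewrite !nth_default ?subrr ?size_u ?size_l.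
  have -> : j = m by apply/eqP; rewrite eqn_leq le_mj le_jm.
  rewrite -{1}[m]/(m.+1.-1) -{1}size_u -[X in _ - l`_X]/(m.+1.-1) -size_l.
  by rewrite -!lead_coefE lc_l subrr.
(* The leading coefficients of [u - p] and [p - l] are nonnegative, so the leading terms cannot
   cancel in the sum [u - l], which has size at most [m]. *)
have size_up : (size (u - p)%R <= m)%N.
  rewrite leqNgt; apply/negP => lt_m.
  have ul : u - l = (u - p) + (p - l) by rewrite addrA subrK.
  have lc_gt0 : 0 < lead_coef (u - p).
    rewrite lt_def lc_ul.1 andbT lead_coef_eq0 -size_poly_gt0.
    exact: leq_trans lt_m.
  have [lt_ab|lt_ba|eq_ab] := ltngtP (size (u - p)) (size (p - l)).
  - by move: size_ul; rewrite ul addrC size_polyDl // leqNgt (ltn_trans lt_m).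
  - by move: size_ul; rewrite ul size_polyDl // leqNgt lt_m.
  have le_m : (m <= (size (u - p)%R).-1)%N.
    by rewrite -ltnS prednK // (leq_trans _ lt_m).
  have := leq_sizeP _ _ size_ul _ le_m.
  rewrite ul coefD -lead_coefE eq_ab -lead_coefE => lc0.
  by have := ltr_wpDr lc_ul.2 lc_gt0; rewrite lc0 ltxx.
have size_p : size p = m.+1.
  by rewrite -[p](subKr u) size_polyDl ?size_polyN ?size_u.
split=> //; rewrite -lc_u -[p](subKr u) lead_coefDl // size_polyN size_u.
exact: size_up.
Qed.

(** * Multivariate polynomials and dimension counts *)

(** In characteristic 0 the polynomial ['X^n - 1] is separable, so it has [n] distinct roots, and
    one of them is primitive. *)
Lemma closed_prim_root_exists (F : numClosedFieldType) n :
  (0 < n)%N -> exists z : F, n.-primitive_root z.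
Proof.
move=> n_gt0; pose p : {poly F} := 'X^n - 1.
have [r Dp] := closed_field_poly_normal p.
rewrite (monicP _) ?monicXnsubC // scale1r in Dp.
have rn1: all n.-unity_root r by apply/allP=> z; rewrite -root_prod_XsubC -Dp.
have sz_r: (n < (size r).+1)%N.
  by rewrite -(size_prod_XsubC r id) -Dp size_XnsubC.
have [|z] := hasP (has_prim_root n_gt0 rn1 _ sz_r); last by exists z.
by rewrite -separable_prod_XsubC -Dp separable_Xn_sub_1 // pnatr_eq0 -lt0n.
Qed.

Lemma digits_inj n D (g h : 'I_n -> nat) :
    (forall i, g i < D)%N -> (forall i, h i < D)%N ->
    (\sum_i g i * D ^ i = \sum_i h i * D ^ i)%N ->
  g =1 h.
Proof.
elim: n g h => [|n IHn] g h gD hD; first by move=> _ [].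
have D_gt0 : (0 < D)%N by apply: leq_ltn_trans (gD ord0).
rewrite !big_ord_recl !expn0 !muln1.
under eq_bigr do rewrite expnS mulnCA.
under [in RHS]eq_bigr do rewrite expnS mulnCA.
rewrite -!big_distrr /= => eq_gh.
have eq0 : g ord0 = h ord0.
  have := congr1 (modn^~ D) eq_gh; rewrite ![(_ ord0 + _)%N]addnC !(mulnC D).
  by rewrite !modnMDl !modn_small.
move: eq_gh; rewrite eq0 => /addnI/eqP; rewrite eqn_pmul2l // => /eqP eq_gh i.
case: (unliftP ord0 i) => [j ->|->] //.
exact: (IHn (g \o lift ord0) (h \o lift ord0) (fun=> gD _) (fun=> hD _) eq_gh).
Qed.

(* Kronecker substitution X_i := T^(D^i) with D larger than the degree. *)
Lemma meval_eq0 (F : numDomainType) n (f : {mpoly F[n]}) :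
  (forall v, f.@[v] = 0) -> f = 0.
Proof.
move=> f0; apply/eqP; apply: contraT => f_neq0.
pose D := msize f; pose w (m : 'X_{1..n}) := (\sum_i m i * D ^ i)%N.
pose P : {poly F} := \sum_(m <- msupp f) f@_m *: 'X^(w m).
have P_eval t : P.[t] = f.@[fun i => t ^+ (D ^ i)].
  rewrite horner_sum mevalE; apply: eq_bigr => m _.
  rewrite hornerZ hornerXn; congr (_ * _); rewrite /w -prodrXr.
  by apply: eq_bigr => i _; rewrite -exprM mulnC.
have P0 : P = 0.
  apply: (@roots_geq_poly_eq0 _ _ [seq i%:R | i <- iota 0 (size P)]).
  - by apply/allP => _ /mapP[i _ ->]; rewrite rootE P_eval f0.
  - by rewrite map_inj_uniq ?iota_uniq // => i j /eqP; rewrite eqr_nat => /eqP.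
  - by rewrite size_map size_iota.
have m_in := mlead_supp f_neq0; set m := mlead f in m_in.
have := congr1 (fun p : {poly F} => p`_(w m)) P0; rewrite coef0 coef_sum.
rewrite (bigD1_seq m) ?msupp_uniq //= coefZ coefXn eqxx mulr1 big1_seq ?addr0.
  by move/eqP; rewrite mcoeff_eq0 m_in.
move=> m' /andP[m'm m'_in]; rewrite coefZ coefXn.
case: eqP => [/digits_inj eq_m|]; last by rewrite mulr0.
case/eqP: m'm; apply/esym/mnmP => i; apply: eq_m => {}i.
  by apply: leq_ltn_trans (msize_mdeg_lt m_in); rewrite mdegE (bigD1 i) ?leq_addr.
by apply: leq_ltn_trans (msize_mdeg_lt m'_in); rewrite mdegE (bigD1 i) ?leq_addr.
Qed.

(** The product of the linear forms is a nonzero polynomial, so by [meval_eq0] it is nonzero at some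
    point. *)
Lemma avoid_hyperplanes (F : numDomainType) n (T : finType) (P : pred T)
    (c : T -> 'I_n -> F) :
  (forall t, P t -> exists i, c t i != 0) ->
  exists x : 'I_n -> F, forall t, P t -> \sum_i x i * c t i != 0.
Proof.
move=> c_neq0; pose f t : {mpoly F[n]} := \sum_i c t i *: 'X_i.
have fE t v : (f t).@[v] = \sum_i v i * c t i.
  by rewrite raddf_sum; apply: eq_bigr => i _; rewrite /= mevalZ mevalXU mulrC.
have prod_neq0 : \prod_(t | P t) f t != 0.
  apply/prodf_neq0 => t /c_neq0[i ci]; apply: contraNneq ci => ft0.
  have := congr1 (fun p : {mpoly F[n]} => p@_(U_(i))%MM) ft0.
  rewrite mcoeff0 raddf_sum (bigD1 i) //= big1 ?addr0 => [|j ji].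
    by rewrite mcoeffZ mcoeffXU eqxx mulr1 => ->.
  by rewrite mcoeffZ mcoeffXU (negPf ji) mulr0.
have [x xP] : exists x : 'I_n -> F, (\prod_(t | P t) f t).@[x] != 0.
  apply: contrapT => no_x; case/eqP: prod_neq0; apply: meval_eq0 => v.
  by apply: contrapT => /eqP nz; apply: no_x; exists v.
exists x => t Pt; rewrite -fE; apply: contraNneq xP => ft0.
by rewrite rmorph_prod /= (bigD1 t) //= ft0 mul0r.
Qed.

Section Codimension.
Variables (F : fieldType) (T V : vectType F) (U : {vspace V}).

(** When [U] consists of the forms of degree [d] vanishing on [X], this codimension is
    [hilbert_fun X d]; [codim_le] and [codim_ge] serve for its two bounds. *)
Lemma codim_le m (phi : {linear V -> 'rV[F]_m}) :
  (forall f, phi f = 0 -> f \in U) ->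
  (\dim (fullv : {vspace V}) - \dim U <= m)%N.
Proof.
move=> kerU; rewrite leq_subLR -(limg_ker_dim (linfun phi) fullv) capfv.
apply: leq_add; last by rewrite (leq_trans (dimvS (subvf _))) // dimvf dim_matrix mul1r.
by apply/dimvS/subvP => f; rewrite memv_ker lfunE /= => /eqP; apply: kerU.
Qed.

Lemma codim_ge (psi : {linear T -> V}) :
  (forall t, psi t \in U -> t = 0) ->
  (dim T <= \dim (fullv : {vspace V}) - \dim U)%N.
Proof.
move=> psiU; have ker0 : lker (linfun psi) = 0%VS.
  apply/eqP; rewrite -subv0; apply/subvP => t; rewrite memv_ker lfunE /= memv0.
  by move=> /eqP t0; apply/eqP/psiU; rewrite t0 mem0v.
have dimT : \dim (limg (linfun psi)) = dim T.
  by rewrite limg_dim_eq ?dimvf // ker0 capv0.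
have disj : (limg (linfun psi) :&: U = 0)%VS.
  apply/eqP; rewrite -subv0; apply/subvP => v; rewrite memv_cap memv0.
  by case/andP => /memv_imgP[t _ ->]; rewrite lfunE /= => /psiU->; rewrite linear0.
by rewrite leq_subRL ?dimvS ?subvf // addnC -dimT -dimv_disjoint_sum // dimvS ?subvf.
Qed.

End Codimension.

Section LeadingMonomials.
Variables (F : fieldType) (n d : nat).
Implicit Types (V : {vspace dhomog n.+1 F d}) (f : dhomog n.+1 F d).

(** A form in [V] whose coefficients at [s] are all 0 has no leading monomial, hence is 0.
    Conversely, forms with distinct leading monomials are free: in a relation, the largest leading
    monomial occurs only once. *)
Lemma dim_leading_monomials V (s : seq 'X_{1..n.+1}) : uniq s ->
    (forall m, m \in s <->
       exists2 f, f \in V & (f : {mpoly F[n.+1]}) != 0 /\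
                            mlead (f : {mpoly F[n.+1]}) = m) ->
  \dim V = size s.
Proof.
move=> uniq_s leadP; apply/eqP; rewrite eqn_leq; apply/andP; split.
  pose phi f : 'rV[F]_(size s) :=
    \row_j (f : {mpoly F[n.+1]})@_(nth 0%MM s j).
  have phi_lin : linear phi.
    by move=> a f g; apply/rowP => j; rewrite !mxE linearP.
  pose phiL : {linear dhomog n.+1 F d -> 'rV[F]_(size s)} :=
    HB.pack phi (GRing.isLinear.Build _ _ _ _ phi phi_lin).
  have <- : \dim (linfun phiL @: V) = \dim V.
    apply: limg_dim_eq; apply/eqP; rewrite -subv0; apply/subvP => f.
    rewrite memv_cap memv_ker lfunE /= memv0 => /andP[fV /eqP phi0].
    apply: contraT => f0.
    have f0' : (f : {mpoly F[n.+1]}) != 0 by [].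
    have lead_s : mlead (f : {mpoly F[n.+1]}) \in s by apply/leadP; exists f.
    have lt_s : (index (mlead (f : {mpoly F[n.+1]})) s < size s)%N.
      by rewrite index_mem.
    have := congr1 (fun r : 'rV_(size s) => r 0 (Ordinal lt_s)) phi0.
    rewrite !mxE /= nth_index // => /eqP.
    by rewrite mleadc_eq0 (negPf f0').
  by rewrite (leq_trans (dimvS (subvf _))) // dimvf dim_matrix mul1r.
have [g gP] : exists g : 'I_(size s) -> dhomog n.+1 F d, forall j,
    [/\ g j \in V, (g j : {mpoly F[n.+1]}) != 0
      & mlead (g j : {mpoly F[n.+1]}) = nth 0%MM s j].
  suff /choice[g gP] : forall j : 'I_(size s), exists f,
    [/\ f \in V, (f : {mpoly F[n.+1]}) != 0
      & mlead (f : {mpoly F[n.+1]}) = nth 0%MM s j] by exists g.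
  by move=> j; have /leadP[f fV [f0 fs]] := mem_nth 0%MM (ltn_ord j); exists f.
have free_g : free [tuple g j | j < size s].
  apply/freeP => c; under eq_bigr do rewrite nth_mktuple.
  move=> /(congr1 (@mpoly_of_dhomog _ _ _)); rewrite raddf_sum /= => sum0 i.
  apply/eqP; apply: contraT => ci.
  have [j cj j_max] : exists2 j, c j != 0 & forall j', c j' != 0 ->
      (nth 0%MM s j' <= nth 0%MM s j)%O.
    by have [j cj j_max] := @arg_maxP _ _ _ i (fun j => c j != 0)
      (fun j : 'I_(size s) => nth 0%MM s j) ci; exists j.
  have := congr1 (mcoeff (nth 0%MM s j)) sum0.
  rewrite mcoeff0 raddf_sum (bigD1 j) //= big1 ?addr0 => [|j' j'j].
    rewrite mcoeffZ; have [_ gj0 <-] := gP j.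
    by move/eqP; rewrite mulf_eq0 (negPf cj) mleadc_eq0 (negPf gj0).
  rewrite mcoeffZ.
  have [->|cj'] := eqVneq (c j') 0; first by rewrite mul0r.
  rewrite mcoeff_gt_mlead ?mulr0 //; have [_ _ ->] := gP j'.
  rewrite lt_neqAle j_max // andbT nth_uniq //.
rewrite -[size s](size_tuple [tuple g j | j < size s]).
rewrite -(eqP free_g) dimvS //; apply/span_subvP => _ /mapP[j _ ->].
by have [] := gP j.
Qed.

End LeadingMonomials.

Definition monomials n d : seq 'X_{1..n} :=
  [seq Multinom t | t <- pmap (insub : seq nat -> option (n.-tuple nat))
                            (compositions n d)].

Lemma mem_monomials n d (m : 'X_{1..n}) : (m \in monomials n d) = (mdeg m == d).
Proof.
have sumn_m : sumn (val (val m)) = mdeg m by rewrite /mdeg sumnE.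
case: m sumn_m => t /= sumn_m; rewrite mem_map => [|? ? [->]] //.
by rewrite mem_pmap_sub mem_compositions size_tuple eqxx sumn_m.
Qed.

Lemma monomials_uniq n d : uniq (monomials n d).
Proof.
rewrite map_inj_uniq => [|? ? [->]] //.
exact/pmap_sub_uniq/compositions_uniq.
Qed.

Lemma map_monomials n d :
  [seq val (val m) | m <- monomials n d] = compositions n d.
Proof.
rewrite -map_comp (eq_map (g := val)) // pmap_filter; last exact: insubK.
apply/all_filterP/allP => t; rewrite mem_compositions => /andP[/eqP st _].
by rewrite insubT ?st.
Qed.

(** Counted as the dimension of the space of all forms over [rat], whose leading monomials are
    exactly these. *)
Lemma size_monomials n d : size (monomials n.+1 d) = 'C(d + n, n).
Proof.
have := @dimvf rat (dhomog n.+1 rat d).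
rewrite (@dim_leading_monomials _ _ _ _ (monomials n.+1 d)) ?monomials_uniq //.
  move=> ->; rewrite -[RHS]bin_sub ?leq_addl // addnK.
  reflexivity.
move=> m; rewrite mem_monomials; split=> [dm|[f _ [f0 <-]]].
  have Xh : 'X_[rat, m] \is d.-homog by rewrite dhomogX.
  by exists (DHomog Xh); rewrite ?memvf //= mleadXm -msize_poly_eq0 msizeX.
exact/eqP/(dhomog_mf (dhomog_is_dhomog f))/mlead_supp.
Qed.

(** * Existence of the Hilbert polynomial *)

Lemma dim_dhomog (F : fieldType) n d :
  \dim (fullv : {vspace dhomog n.+1 F d}) = 'C(d + n, n).
Proof. by rewrite dimvf /= -[RHS]bin_sub ?leq_addl // addnK. Qed.

Section HilbertPolynomial.
Variables (F : fieldType) (n : nat) (X : set (projspace F n)).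

(* The exponents of the initial ideal of the homogeneous ideal of [X]. *)
Definition initial_exponent (t : seq nat) : bool :=
  `[< exists m : 'X_{1..n.+1}, exists f : {mpoly F[n.+1]},
      [/\ val (val m) = t, f \is (mdeg m).-homog, f != 0, mlead f = m
        & forall P, X P -> forall x, x \in sval P -> f.@[x 0] = 0] >].

(** Multiplying a vanishing form by a monomial multiplies its leading monomial by it. *)
Lemma initial_exponent_up_closed : up_closed n.+1 initial_exponent.
Proof.
move=> t t' st le_tt' /asboolP[m [f [mt fh f0 fm fX]]].
have st' : size t' == n.+1 by rewrite -st all2E in le_tt' *; case/andP: le_tt' => /eqP->.
pose m' : 'X_{1..n.+1} := Multinom (Tuple st').
have le_mm' : (m <= m')%MM.
  apply/mnm_lepP => i; rewrite !(mnm_nth 0%N) /= mt.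
  move: le_tt'; rewrite all2E => /andP[_ /(all_nthP (0, 0)%N)/(_ i)].
  rewrite size_zip (eqP st') st minnn ltn_ord => /(_ isT).
  by rewrite nth_zip // st (eqP st').
have mm' : (m + (m' - m))%MM = m' by rewrite addmC submK.
apply/asboolP; exists m', (f * 'X_[m' - m]); split=> //.
- by rewrite -[in X in X.-homog]mm' mdegD dhomogM // dhomogX.
- by rewrite mulf_neq0 // -msize_poly_eq0 msizeX.
- by rewrite mleadM ?fm ?mleadXm // -msize_poly_eq0 msizeX.
- by move=> P XP x xP; rewrite mevalM (fX P XP x xP) mul0r.
Qed.

(** Macaulay's theorem: the monomials outside the initial ideal count the dimension of the
    quotient. *)
Lemma hilbert_fun_count d :
  hilbert_fun X d = count (predC initial_exponent) (compositions n.+1 d).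
Proof.
have szE := count_predC initial_exponent (compositions n.+1 d).
rewrite /hilbert_fun dim_dhomog -size_monomials -(size_map (fun m => val (val m))).
rewrite map_monomials -szE.
rewrite (@dim_leading_monomials _ _ _ _
    [seq m <- monomials n.+1 d | initial_exponent (val (val m))]).
- by rewrite size_filter -(count_map (fun m => val (val m))) map_monomials addKn.
- exact/filter_uniq/monomials_uniq.
move=> m; rewrite mem_filter mem_monomials; split.
  move=> /andP[/asboolP[m' [f [/val_inj/val_inj-> fh f0 fm fX]]] /eqP dm].
  rewrite dm in fh; exists (DHomog fh) => //.
  by apply/vanishing_formsP.
move=> [f /vanishing_formsP fX [f0 fm]].
have dm : mdeg m = d.
  by rewrite -fm; apply/(dhomog_mf (dhomog_is_dhomog f))/mlead_supp.
rewrite dm eqxx andbT; apply/asboolP; exists m, f; split=> //.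
by rewrite dm dhomog_is_dhomog.
Qed.

Lemma hilbert_fun_eventually_poly :
  eventually_poly (fun d => (hilbert_fun X d)%:R).
Proof.
have [p [d0 pE]] := count_up_closedC initial_exponent_up_closed.
by exists p, d0 => d le_d; rewrite hilbert_fun_count pE.
Qed.

End HilbertPolynomial.

Section PartialDegree.
Variables (n : nat) (P : pred 'I_n).

(** As a measure, it expresses homogeneity in the variables selected by [P] alone. *)
Definition pdeg (m : 'X_{1..n}) : nat := (\sum_(i | P i) m i)%N.

Lemma pdeg0 : pdeg 0%MM = 0%N.
Proof. by rewrite /pdeg big1 // => i _; rewrite mnm0E. Qed.

Lemma pdegD : {morph pdeg : m1 m2 / (m1 + m2)%MM >-> (m1 + m2)%N}.
Proof.
by move=> m1 m2; rewrite -big_split; apply: eq_bigr => i _; rewrite mnmDE.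
Qed.

HB.instance Definition _ := isMeasure.Build n pdeg pdeg0 pdegD.

End PartialDegree.

Lemma dhomog_comp_mpolyX (F : fieldType) n k (mf : measure k)
    (u : n.-tuple {mpoly F[k]}) (e : 'I_n -> nat) (m : 'X_{1..n}) :
  (forall i, tnth u i \is (e i).-homog for mf) ->
  'X_[m] \mPo u \is ((\sum_i e i * m i)%N).-homog for mf.
Proof.
move=> uh; rewrite comp_mpolyX.
apply: (big_rec2 (fun (p : {mpoly F[k]}) d => p \is d.-homog for mf)).
  exact: dhomog1.
by move=> i d p _ ph; apply: dhomogM => //; apply: dhomogMn.
Qed.

Lemma dhomog_comp_mpoly (F : fieldType) n k (u : n.-tuple {mpoly F[k]}) c d
    (f : {mpoly F[n]}) :
    (forall i, tnth u i \is c.-homog) -> f \is d.-homog ->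
  f \mPo u \is (c * d).-homog.
Proof.
move=> uh fh; rewrite comp_mpolyEX; rewrite big_seq.
apply: rpred_sum => m m_in; apply: dhomogZ.
have := dhomog_comp_mpolyX m uh.
by rewrite -big_distrr /= -mdegE (dhomog_mf fh m_in).
Qed.

(** * Upper bound *)

Section RowGraph.
Variables (F : fieldType) (k n : nat) (G : 'M[F]_(k, n)).

Definition row_adj : rel 'I_k :=
  fun a a' => [exists i, (G a i != 0) && (G a' i != 0)].

Definition row_rep (a : 'I_k) : 'I_k := fingraph.root row_adj a.

Lemma row_adj_connect_sym : connect_sym row_adj.
Proof. by apply: sym_connect_sym => a a'; apply: eq_existsb => i; rewrite andbC. Qed.

Lemma row_rep_eq a a' i : G a i != 0 -> G a' i != 0 -> row_rep a = row_rep a'.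
Proof.
move=> ai a'i; apply/eqP; rewrite root_connect; last exact: row_adj_connect_sym.
by apply: connect1; apply/existsP; exists i; rewrite ai.
Qed.

Lemma row_repK a : row_rep (row_rep a) = row_rep a.
Proof. exact: eqP (roots_root row_adj_connect_sym a). Qed.

(** Its cardinal is the exponent of [r] in the degree; both bounds are indexed by functions from it
    to ['I_r]. *)
Definition nonrep : finType := {a : 'I_k | row_rep a != a}.

Lemma card_nonrep : #|nonrep| = (k - #|[set row_rep a | a : 'I_k]|)%N.
Proof.
rewrite card_sig -[X in (X - _)%N](card_ord k).
rewrite -(cardsC [set row_rep a | a : 'I_k]) addKn.
have <- : [set a | row_rep a != a] = ~: [set row_rep a | a : 'I_k].
  apply/setP => a; rewrite !inE; congr (~~ _).
  apply/eqP/imsetP => [<-|[b _ ->]]; last exact: row_repK.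
  by exists a.
by rewrite cardsE.
Qed.

End RowGraph.

Section UpperBound.
Variables (F : fieldType) (k n r : nat) (G : 'M[F]_(k.+1, n.+1)).
Hypothesis r_gt0 : (0 < r)%N.
Local Notation rep := (row_rep G).

Definition column_form (i : 'I_n.+1) : {mpoly F[k.+1]} := \sum_a G a i *: 'X_a.

Definition column_powers := [tuple column_form i ^+ r | i < n.+1].

Lemma column_form_homog i : column_form i \is 1.-homog.
Proof. by apply: rpred_sum => a _; apply: dhomogZ; rewrite dhomogX /= mdeg1. Qed.

Definition class_balanced (m : 'X_{1..k.+1}) : bool :=
  [forall c, (r %| pdeg (fun a => rep a == c) m)%N].

(** The variables of one column form lie in one class, so the form is homogeneous of degree 0 or 1
    in the variables of the class [c], and its [r]-th power of degree 0 or [r]. *)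
Lemma msupp_column_powers (f : {mpoly F[n.+1]}) m :
  (f \mPo column_powers)@_m != 0 -> class_balanced m.
Proof.
rewrite comp_mpolyEX raddf_sum /= => sum_neq0; apply/forallP => c.
pose P a := rep a == c; rewrite -/P.
pose e i : nat := [exists a, (G a i != 0) && P a].
have [mu mu_neq0] : exists mu : 'X_{1..n.+1}, ('X_[F, mu] \mPo column_powers)@_m != 0.
  apply: contrapT => no_mu; case/eqP: sum_neq0; apply: big1 => mu _.
  rewrite mcoeffZ; apply/eqP; rewrite mulf_eq0; apply/orP; right.
  by apply: contraT => mu0; case: no_mu; exists mu.
have form_homog i : column_form i \is (e i).-homog for (pdeg P).
  apply: rpred_sum => a _; have [->|Gai] := eqVneq (G a i) 0.
    by rewrite scale0r rpred0.
  apply: dhomogZ; rewrite dhomogX /=; apply/eqP.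
  rewrite /pdeg big_mkcond (bigD1 a) //= big1 => [|b ba]; last first.
    by rewrite mnm1E eq_sym (negPf ba) if_same.
  rewrite mnm1E eqxx addn0 /e; congr nat_of_bool.
  apply/idP/existsP => [Pa|[a' /andP[Ga'i]]]; first by exists a; rewrite Gai.
  by rewrite /P (row_rep_eq Ga'i Gai).
have pow_homog i : tnth column_powers i \is (e i * r).-homog for (pdeg P).
  by rewrite tnth_mktuple dhomogMn.
have /dhomogP/(_ m) := dhomog_comp_mpolyX mu pow_homog.
rewrite mcoeff_msupp => /(_ mu_neq0) /= ->.
by apply: dvdn_sum => i _; rewrite dvdn_mulr // dvdn_mull.
Qed.

(** A balanced monomial is recovered from its quotient by [r] and its residues modulo [r] at the
    non-representatives: balance yields the residues at the representatives. *)
Lemma size_class_balanced d :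
  (size [seq m <- monomials k.+1 (r * d) | class_balanced m] <=
     r ^ #|nonrep G| * 'C(d + k, k))%N.
Proof.
set s := filter _ _.
pose quot (m : 'X_{1..k.+1}) := (\sum_a m a %/ r)%N.
(* The quotient may have degree below [d]; the exponent at [ord0] is raised to reach degree [d]
   exactly. *)
pose g (m : 'X_{1..k.+1}) : {ffun nonrep G -> 'I_r} * 'X_{1..k.+1} :=
  ([ffun a => Ordinal (ltn_pmod (m (val a)) r_gt0)],
   [multinom (m a %/ r + (a == ord0) * (d - quot m))%N | a < k.+1]).
have degE (m : 'X_{1..k.+1}) : m \in s ->
    (r * d = quot m * r + \sum_a m a %% r)%N.
  rewrite mem_filter mem_monomials => /andP[_ /eqP <-].
  by rewrite mdegE big_distrl -big_split; apply: eq_bigr => a _; apply: divn_eq.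
have g_sub : {subset [seq g m | m <- s] <=
    [seq (z, m) | z <- enum {ffun nonrep G -> 'I_r}, m <- monomials k.+1 d]}.
  move=> _ /mapP[m ms ->]; apply: allpairs_f; first by rewrite mem_enum inE.
  rewrite mem_monomials mdegE; under eq_bigr do rewrite mnmE.
  rewrite big_split /= [X in (_ + X)%N](bigD1 ord0) //=.
  rewrite [X in (_ + (_ + X))%N]big1 => [|a /negPf->] //.
  rewrite -/(quot m) mul1n addn0 subnKC // -(leq_pmul2r r_gt0) [leqRHS]mulnC.
  by rewrite (degE m ms) leq_addr.
have g_inj : {in s &, injective g}.
  move=> m m' ms m's eq_g.
  have /ffunP eq_mod := congr1 fst eq_g; have /= eq_quot := congr1 snd eq_g.
  have eq_modN a : rep a != a -> m a = m' a %[mod r].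
    by move=> ra; have := eq_mod (exist _ a ra); rewrite !ffunE => -[].
  have eq_modE a : (m a %% r = m' a %% r)%N.
    have [ra|] := eqVneq (rep a) a; last exact: eq_modN.
    have bal (m0 : 'X_{1..k.+1}) : m0 \in s ->
        (m0 a + \sum_(b | (rep b == a) && (b != a)) m0 b = 0 %[mod r])%N.
      rewrite mem_filter mod0n => /andP[/forallP/(_ a) + _].
      by rewrite /pdeg (bigD1 a) ?ra //= => /eqP.
    have eq_rest : (\sum_(b | (rep b == a) && (b != a)) m b =
                    \sum_(b | (rep b == a) && (b != a)) m' b %[mod r])%N.
      rewrite -modn_summ -[in RHS]modn_summ; congr (_ %% _)%N.
      apply: eq_bigr => b /andP[/eqP rb ba]; apply: eq_modN.
      by rewrite rb eq_sym.
    apply/eqP; rewrite -(eqn_modDr (\sum_(b | (rep b == a) && (b != a)) m b)%N).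
    by rewrite bal // -modnDmr eq_rest modnDmr bal.
  (* The residues and the total degree fix the degree of the quotient, hence the padding at
     [ord0]. *)
  have eq_quotE : quot m = quot m'.
    apply/eqP; rewrite -(eqn_pmul2r r_gt0) -(eqn_add2r (\sum_a m a %% r)%N).
    rewrite -degE //; under [X in (_ + X)%N]eq_bigr do rewrite eq_modE.
    by rewrite -degE.
  apply/mnmP => a; rewrite (divn_eq (m a) r) (divn_eq (m' a) r) eq_modE.
  congr (_ * _ + _)%N; have := (mnmP _ _).1 eq_quot a; rewrite !mnmE eq_quotE.
  exact: addIn.
have -> : (r ^ #|nonrep G| = size (enum {ffun nonrep G -> 'I_r}))%N.
  by rewrite -cardE card_ffun card_ord.
rewrite -size_monomials -(size_allpairs pair) -(size_map g).
apply: uniq_leq_size => //.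
by rewrite map_inj_in_uniq // filter_uniq ?monomials_uniq.
Qed.

(** A form is sent to the coefficients of its pullback at the balanced monomials of degree [r * d];
    the others vanish by [msupp_column_powers]. *)
Lemma codim_upper_bound d (U : {vspace dhomog n.+1 F d}) :
    (forall f : dhomog n.+1 F d,
       (f : {mpoly F[n.+1]}) \mPo column_powers = 0 -> f \in U) ->
  (\dim (fullv : {vspace dhomog n.+1 F d}) - \dim U <=
     r ^ #|nonrep G| * 'C(d + k, k))%N.
Proof.
move=> kerU; pose s := [seq m <- monomials k.+1 (r * d) | class_balanced m].
pose phi (f : dhomog n.+1 F d) : 'rV[F]_(size s) :=
  \row_j ((f : {mpoly F[n.+1]}) \mPo column_powers)@_(nth 0%MM s j).
have phi_lin : linear phi by move=> a f g; apply/rowP => j; rewrite !mxE !linearP.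
pose phiL : {linear dhomog n.+1 F d -> 'rV[F]_(size s)} :=
  HB.pack phi (GRing.isLinear.Build _ _ _ _ phi phi_lin).
apply: leq_trans (size_class_balanced d); apply: (@codim_le _ _ _ _ phiL) => f phi0.
apply/kerU/mpolyP => m; rewrite mcoeff0; apply/eqP; apply: contraT => m_neq0.
have m_s : m \in s.
  rewrite mem_filter (msupp_column_powers m_neq0) mem_monomials.
  have u_homog i : tnth column_powers i \is r.-homog.
    by rewrite tnth_mktuple; have := dhomogMn r (column_form_homog i); rewrite mul1n.
  have /dhomogP/(_ m) := dhomog_comp_mpoly u_homog (dhomog_is_dhomog f).
  by rewrite mcoeff_msupp => /(_ m_neq0)/eqP.
have lt_s : (index m s < size s)%N by rewrite index_mem.
have := congr1 (fun v : 'rV_(size s) => v 0 (Ordinal lt_s)) phi0.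
by rewrite !mxE /= nth_index // => /eqP; rewrite (negPf m_neq0).
Qed.

End UpperBound.

(** * Lower bound *)

Lemma connect_eq_fun (T : finType) (rT : eqType) (e : rel T) (f : T -> rT) :
  (forall x y, e x y -> f x = f y) -> forall x y, connect e x y -> f x = f y.
Proof.
move=> ef x y xy; have cl : closed e [pred z | f z == f x].
  by move=> z t /ef; rewrite !inE => ->.
by have := closed_connect cl xy; rewrite !inE eqxx => /esym/eqP.
Qed.

Section LowerBound.
Variables (F : numClosedFieldType) (k n r : nat) (G : 'M[F]_(k.+1, n.+1)).
Hypothesis r_gt0 : (0 < r)%N.
Local Notation rep := (row_rep G).
Local Notation Z := {ffun nonrep G -> 'I_r}.
Local Notation N := (r ^ #|nonrep G|)%N.

Variable b : 'I_k.+1 -> 'I_n.+1.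
Hypothesis Gb : forall a a', G a (b a') = (a == a')%:R.

Variable w : F.
Hypothesis w_prim : r.-primitive_root w.

(** Being 1 at the representatives normalises the twist modulo those constant on the classes. *)
Definition twist (z : Z) (a : 'I_k.+1) : F :=
  if insub a is Some j then w ^+ z j else 1.

Lemma twistX z a : twist z a ^+ r = 1.
Proof.
rewrite /twist; case: insub => [j|]; last by rewrite expr1n.
by rewrite exprAC (prim_expr_order w_prim) expr1n.
Qed.

Lemma twist_neq0 z a : twist z a != 0.
Proof.
apply: contra_eqT (twistX z a) => /negPn/eqP->.
by rewrite expr0n gtn_eqF // eq_sym oner_eq0.
Qed.

Lemma twist_rep z a : twist z (rep a) = 1.
Proof. by rewrite /twist insubF // row_repK eqxx. Qed.

Lemma twist_inj : injective (fun z => [ffun a => twist z a]).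
Proof.
move=> z z' /ffunP eq_zz'; apply/ffunP => j; apply/val_inj => /=.
have := eq_zz' (val j); rewrite !ffunE /twist valK.
by move/eqP; rewrite (eq_prim_root_expr w_prim) !modn_small // => /eqP.
Qed.

Definition twisted_form z (y : 'I_k.+1 -> F) i := \sum_a twist z a * y a * G a i.

Lemma twisted_form_basis z y a : twisted_form z y (b a) ^+ r = y a ^+ r.
Proof.
rewrite /twisted_form (bigD1 a) //= big1 ?addr0 => [|a' a'a].
  by rewrite Gb eqxx mulr1 exprMn twistX mul1r.
by rewrite Gb (negPf a'a) mulr0.
Qed.

(* A point where the z-twist of a column form vanishes and its z'-twist does
   not, unless z and z' have the same ratios along the edges. *)
Lemma twisted_form_separate z z' : z != z' ->
  exists y i, twisted_form z y i ^+ r != twisted_form z' y i ^+ r.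
Proof.
move=> zz'; apply: contrapT => same; case/eqP: zz'; apply: twist_inj.
have adj a a' : row_adj G a a' -> twist z' a / twist z a = twist z' a' / twist z a'.
  case/existsP => i /andP[Ga Ga'].
  (* The point is supported on [a] and [a'], with values making the two terms of the [z]-twist
     cancel. Written as a sum, it also covers [a = a']. *)
  pose u := G a' i * twist z a'; pose v := - (G a i * twist z a).
  pose y c := (c == a)%:R * u + (c == a')%:R * v.
  have formE z0 : twisted_form z0 y i =
      twist z0 a * u * G a i + twist z0 a' * v * G a' i.
    rewrite /twisted_form; under eq_bigr do rewrite mulrDr mulrDl.
    rewrite big_split /=; congr (_ + _).
      rewrite (bigD1 a) //= big1 ?addr0 ?eqxx ?mul1r // => c /negPf->.
      by rewrite mul0r mulr0 mul0r.
    rewrite (bigD1 a') //= big1 ?addr0 ?eqxx ?mul1r // => c /negPf->.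
    by rewrite mul0r mulr0 mul0r.
  have z0 : twisted_form z y i = 0 by rewrite formE /u /v; ring.
  have /eqP : twisted_form z' y i ^+ r = 0.
    apply: contrapT => nz; apply: same; exists y, i.
    by rewrite z0 expr0n gtn_eqF // eq_sym; apply/eqP.
  rewrite expf_eq0 r_gt0 /= formE => /eqP z'0.
  apply/eqP; rewrite eqr_div ?twist_neq0 //; apply/eqP.
  apply: (mulfI Ga); apply: (mulfI Ga'); apply/eqP; rewrite -subr_eq0 -z'0 /u /v.
  by apply/eqP; ring.
apply/ffunP => a; rewrite !ffunE.
(* The ratio is constant along edges, hence on classes, and it is 1 at the representatives. *)
have : twist z' a / twist z a = twist z' (rep a) / twist z (rep a).
  by apply: (connect_eq_fun adj); apply: connect_root.
by rewrite !twist_rep divr1 => /divr1_eq.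
Qed.

(** This yields the primitive element [a]. Each of the finitely many pairs of twists excludes one
    hyperplane of coefficients [l]; the point [y] may depend on the pair. *)
Lemma separating_combination : exists l : 'I_n.+1 -> F,
  forall z z' : Z, z != z' -> exists y,
    \sum_i l i * twisted_form z y i ^+ r != \sum_i l i * twisted_form z' y i ^+ r.
Proof.
have [Y YP] : exists Y : Z * Z -> 'I_k.+1 -> F, forall t, t.1 != t.2 ->
    exists i, twisted_form t.1 (Y t) i ^+ r != twisted_form t.2 (Y t) i ^+ r.
  suff /choice[Y YP] : forall t : Z * Z, exists y : 'I_k.+1 -> F, t.1 != t.2 ->
    exists i, twisted_form t.1 y i ^+ r != twisted_form t.2 y i ^+ r by exists Y.
  move=> t; have [|/twisted_form_separate[y yP]] := eqVneq t.1 t.2; last by exists y.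
  by exists (fun=> 0).
have [t /YP[i ti]|l lP] := @avoid_hyperplanes F n.+1 (Z * Z)%type
  (fun t => t.1 != t.2) (fun t i => twisted_form t.1 (Y t) i ^+ r -
                                    twisted_form t.2 (Y t) i ^+ r).
  by exists i; rewrite subr_eq0.
exists l => z z' zz'; exists (Y (z, z')); have := lP (z, z') zz'.
by under eq_bigr do rewrite mulrBr; rewrite sumrB subr_eq0.
Qed.

Section Embedding.
Variables (e : nat) (l : 'I_n.+1 -> F).
Implicit Type p : {ffun 'I_N -> dhomog k.+1 F e}.

Let lin : {mpoly F[n.+1]} := \sum_i l i *: 'X_i.
Let basis_vars := [tuple 'X_(b a) : {mpoly F[n.+1]} | a < k.+1].

(** It represents the sum of the [p_q a^q], with [lin] for [a] and ['X_(b j)] for the [r]-th power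
    of the coordinate [j]. The powers of ['X_(b ord0)] bring all summands to degree [e + N]. *)
Definition pencil_mpoly p : {mpoly F[n.+1]} :=
  \sum_(q < N) ((p q : {mpoly F[k.+1]}) \mPo basis_vars) *
               ('X_(b ord0) ^+ (N - q) * lin ^+ q).

Lemma pencil_homog p : pencil_mpoly p \is (e + N).-homog.
Proof.
have X_homog i : 'X_i \is [in F[n.+1], 1.-homog] by rewrite dhomogX /= mdeg1.
have lin_homog : lin \is 1.-homog by apply: rpred_sum => i _; apply: dhomogZ.
apply: rpred_sum => q _; apply: dhomogM.
  have vars_homog a : tnth basis_vars a \is 1.-homog by rewrite tnth_mktuple.
  by have := dhomog_comp_mpoly vars_homog (dhomog_is_dhomog (p q)); rewrite mul1n.
have := dhomogM (dhomogMn (N - q) (X_homog (b ord0))) (dhomogMn q lin_homog).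
by rewrite !mul1n subnK // ltnW.
Qed.

Definition pencil p : dhomog n.+1 F (e + N) := DHomog (pencil_homog p).

Lemma pencil_linear : linear pencil.
Proof.
move=> c p p'; apply: val_inj => /=; rewrite /pencil_mpoly scaler_sumr -big_split /=.
by apply: eq_bigr => q _; rewrite !ffunE linearP /= mulrDl -scalerAl.
Qed.

(** The twist enters only through the value of [lin]; the coefficients depend on the [y a ^+ r],
    which it fixes. *)
Lemma pencil_eval p z y :
  (pencil_mpoly p).@[fun i => twisted_form z y i ^+ r] =
  \sum_(q < N) ((p q : {mpoly F[k.+1]}).@[fun a => y a ^+ r] *
     (y ord0 ^+ r) ^+ (N - q)) * (\sum_i l i * twisted_form z y i ^+ r) ^+ q.
Proof.
rewrite raddf_sum; apply: eq_bigr => q _ /=.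
rewrite !mevalM !rmorphXn /= mevalXU twisted_form_basis mulrA; congr (_ * _ * _ ^+ _).
  rewrite comp_mpoly_meval; apply: meval_eq => a.
  by rewrite tnth_mktuple mevalXU twisted_form_basis.
by rewrite raddf_sum; apply: eq_bigr => i _; rewrite /= mevalZ mevalXU.
Qed.

End Embedding.

(* The coefficients of a relation [sum_q p_q(y^r) a^q = 0] are fixed by every
   twist of [y], so the N distinct conjugates of [a] are roots of one polynomial
   of degree < N. *)
Lemma codim_lower_bound e (U : {vspace dhomog n.+1 F (e + N)}) :
    (forall f : dhomog n.+1 F (e + N), f \in U -> forall y,
       (f : {mpoly F[n.+1]}).@[fun i => (\sum_a y a * G a i) ^+ r] = 0) ->
  (N * 'C(e + k, k) <= \dim (fullv : {vspace dhomog n.+1 F (e + N)}) - \dim U)%N.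
Proof.
move=> U0; have [l lP] := separating_combination.
pose psi : {linear {ffun 'I_N -> dhomog k.+1 F e} -> dhomog n.+1 F (e + N)} :=
  HB.pack (pencil l)
    (GRing.isLinear.Build _ _ _ _ (pencil (e := e) l) (@pencil_linear e l)).
have -> : (N * 'C(e + k, k))%N = dim {ffun 'I_N -> dhomog k.+1 F e}.
  rewrite -(dim_dhomog F) dimvf -[X in (X * _)%N]card_ord.
  reflexivity.
apply: (@codim_ge _ _ _ _ psi) => p pU.
pose A z : {mpoly F[k.+1]} := \sum_i l i *: (\sum_a (twist z a * G a i) *: 'X_a) ^+ r.
have AE z y : (A z).@[y] = \sum_i l i * twisted_form z y i ^+ r.
  rewrite raddf_sum; apply: eq_bigr => i _ /=; rewrite mevalZ rmorphXn /=.
  congr (_ * _ ^+ _); rewrite raddf_sum; apply: eq_bigr => a _ /=.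
  by rewrite mevalZ mevalXU mulrAC.
(* Where [D] is nonzero, all conjugates are distinct and the homogenising factor is invertible. *)
pose D := 'X_ord0 * \prod_(t : Z * Z | t.1 != t.2) (A t.1 - A t.2).
have D_neq0 : D != 0.
  rewrite mulf_neq0 -?msize_poly_eq0 ?msizeX // msize_poly_eq0.
  apply/prodf_neq0 => t /lP[y]; apply: contraNneq => At0.
  by rewrite -!AE -subr_eq0 -mevalB At0 meval0.
have pow_eq0 q y : D.@[y] != 0 -> (p q : {mpoly F[k.+1]}).@[fun a => y a ^+ r] = 0.
  rewrite mevalM mevalXU rmorph_prod mulf_eq0 negb_or /= => /andP[y0 /prodf_neq0 Ay].
  pose Q := \poly_(q0 < N) if insub q0 is Some q1 then
    (p q1 : {mpoly F[k.+1]}).@[fun a => y a ^+ r] * (y ord0 ^+ r) ^+ (N - q1) else 0.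
  have Q0 : Q = 0.
    apply: (@roots_geq_poly_eq0 _ _ [seq (A z).@[y] | z <- enum Z]).
    - apply/allP => _ /mapP[z _ ->]; rewrite rootE horner_poly AE; apply/eqP.
      rewrite -[RHS](_ : (pencil_mpoly l p).@[fun i => twisted_form z y i ^+ r] = 0).
        by rewrite pencil_eval; apply: eq_bigr => q0 _; rewrite valK.
      rewrite -[RHS](U0 _ pU (fun a => twist z a * y a)).
      by apply: meval_eq => i.
    - rewrite map_inj_in_uniq ?enum_uniq // => z z' _ _ eqA.
      apply/eqP; apply: contraT => zz'; have := Ay (z, z') zz'.
      by rewrite mevalB eqA subrr eqxx.
    - by rewrite size_map -cardE card_ffun card_ord size_poly.
  have := congr1 (fun P : {poly F} => P`_q) Q0; rewrite coef0 coef_poly ltn_ord valK.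
  by move/eqP; rewrite mulf_eq0 !expf_eq0 (negPf y0) !andbF orbF => /eqP.
apply/ffunP => q; rewrite ffunE; apply: val_inj => /=.
pose pw : {mpoly F[k.+1]} := (p q : {mpoly F[k.+1]}) \mPo [tuple 'X_a ^+ r | a < k.+1].
have pwE y : pw.@[y] = (p q : {mpoly F[k.+1]}).@[fun a => y a ^+ r].
  rewrite comp_mpoly_meval; apply: meval_eq => a.
  by rewrite tnth_mktuple rmorphXn /= mevalXU.
have pw0 : pw = 0.
  apply/eqP; have : pw * D == 0; last by rewrite mulf_eq0 (negPf D_neq0) orbF.
  apply/eqP/meval_eq0 => y; rewrite mevalM.
  by have [->|/pow_eq0 pq0] := eqVneq D.@[y] 0; rewrite ?mulr0 // pwE pq0 mul0r.
(* Every point is a coordinate-wise [r]-th power, so [pw = 0] makes [p q] vanish everywhere. *)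
apply: meval_eq0 => v; have := congr1 (meval (fun a => r.-root (v a))) pw0.
rewrite meval0 pwE => <-.
by apply: meval_eq => a; rewrite rootCK.
Qed.

End LowerBound.

(** * The matroid of a linear space *)

(** The map [b] selects an invertible maximal minor of a basis matrix; multiplying by its inverse
    turns this minor into the identity. *)
Lemma reduced_basis (F : fieldType) (k n : nat) (W : {vspace 'rV[F]_n}) : \dim W = k ->
  exists (G : 'M[F]_(k, n)) (b : 'I_k -> 'I_n),
    (forall a a', G a (b a') = (a == a')%:R) /\
    (forall x, x \in W <-> exists y, x = y *m G).
Proof.
move=> dimW; pose X := tcast dimW (vbasis W).
have spanX : <<X>>%VS = W by rewrite val_tcast; apply/span_basis/vbasisP.
have freeX : free X by rewrite /= val_tcast; apply/basis_free/vbasisP.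
pose M : 'M[F]_(k, n) := \matrix_i X`_i.
have mulM (y : 'rV_k) : y *m M = \sum_i y 0 i *: X`_i.
  by rewrite mulmx_sum_row; apply: eq_bigr => i _; rewrite rowK.
have fullM : row_full M^T.
  rewrite /row_full mxrank_tr; change (row_free M); rewrite -kermx_eq0.
  apply/rowV0P => y /sub_kermxP; rewrite mulM => /(freeP freeX) y0.
  by apply/rowP => i; rewrite y0 mxE.
pose b := fullrankfun fullM; pose B := colsub b M.
have B_unit : B \in unitmx.
  by rewrite -unitmx_tr trmx_mxsub; apply: fullrowsub_unit.
exists (invmx B *m M), b; split.
  move=> a a'; have := mulVmx B_unit => /matrixP/(_ a a'); rewrite [in RHS]mxE => <-.
  by rewrite !mxE; apply: eq_bigr => i _; rewrite !mxE.
move=> x; split=> [xW|[y ->]].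
  have xX : x \in <<X>>%VS by rewrite spanX.
  exists ((\row_i coord X i x) *m B).
  rewrite mulmxA mulmxK // mulM [LHS](coord_span xX).
  by apply: eq_bigr => i _; rewrite mxE.
rewrite mulmxA mulM -spanX; apply: memv_suml => i _; apply/memvZ/memv_span.
by rewrite mem_nth // size_tuple.
Qed.

Section LinearSpace.
Variables (F : fieldType) (k n : nat) (W : {vspace 'rV[F]_n.+1}).
Variables (G : 'M[F]_(k, n.+1)) (b : 'I_k -> 'I_n.+1).
Hypothesis Gb : forall a a', G a (b a') = (a == a')%:R.
Hypothesis GW : forall x, x \in W <-> exists y, x = y *m G.

Let L : set (projspace F n) := [set P | (sval P <= W)%VS]%classic.
Local Notation M := (linear_matroid L).
Local Notation rep := (row_rep G).

Lemma mulmx_basis (y : 'rV_k) a : (y *m G) 0 (b a) = y 0 a.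
Proof.
rewrite mxE (bigD1 a) //= Gb eqxx mulr1 big1 ?addr0 // => a' a'a.
by rewrite Gb (negPf a'a) mulr0.
Qed.

Lemma mulmx_inj0 (y : 'rV_k) : y *m G = 0 -> y = 0.
Proof. by move=> yG; apply/rowP => a; rewrite -mulmx_basis yG !mxE. Qed.

(** Independence of [I] thus says that the columns of [G] outside [I] have rank [k]: the matroid is
    dual to the column matroid of [G]. *)
Lemma linear_matroidP (I : {set 'I_n.+1}) :
  reflect (forall y : 'rV_k, (forall i, i \notin I -> (y *m G) 0 i = 0) -> y = 0)
          (I \in M).
Proof.
apply: (iffP idP); rewrite inE.
  move=> /asboolP LI y y0; apply/eqP; apply: contraT => yn0.
  have x0 : y *m G != 0 by apply: contraNneq yn0 => /mulmx_inj0->.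
  suff : classical_sets.set0 (proj_point x0) by [].
  rewrite -LI; split; rewrite /= -?memvE; first by apply/GW; exists y.
  move=> x /vlineP[c ->] i; rewrite in_setC mxE => /y0->.
  by rewrite mulr0.
move=> MI; apply/asboolP/seteqP; split=> // P [/= LP PI].
have hP : homog_coords P \in sval P by exact: memv_pick.
have /GW[y yE] : homog_coords P \in W by exact: (subvP LP).
have /eqP := homog_coords_neq0 P; apply; rewrite yE (MI y) ?mul0mx // => i iI.
by rewrite -yE (PI _ hP) // in_setC.
Qed.

Lemma linear_matroidS (I J : {set 'I_n.+1}) : I \subset J -> J \in M -> I \in M.
Proof.
move=> /subsetP IJ /linear_matroidP MJ; apply/linear_matroidP => y y0.
by apply: MJ => i iJ; apply: y0; apply: contra iJ; apply: IJ.
Qed.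

(** A zero column, which will turn out to be a coloop, gets a class of its own. *)
Definition column_class (i : 'I_n.+1) : 'I_k + 'I_n.+1 :=
  if [pick a | G a i != 0] is Some a then inl (rep a) else inr i.

Lemma column_class_inl a i : G a i != 0 -> column_class i = inl (rep a).
Proof.
move=> Gai; rewrite /column_class; case: pickP => [a' Ga'i|/(_ a)].
  by rewrite (row_rep_eq Ga'i Gai).
by rewrite Gai.
Qed.

Lemma column_class_basis a : column_class (b a) = inl (rep a).
Proof. by apply: column_class_inl; rewrite Gb eqxx oner_eq0. Qed.

Lemma column_class_inr i : (forall a, G a i = 0) -> column_class i = inr i.
Proof. by move=> Gi; rewrite /column_class; case: pickP => // a; rewrite Gi eqxx. Qed.

Definition column_fiber (i : 'I_n.+1) : {set 'I_n.+1} :=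
  [set j | column_class j == column_class i].

(** The entries [y 0 a] with [b a] in the fiber affect only columns of the fiber, and the others
    only columns outside it. So [y] splits into two parts, each subject to one of the two
    conditions. *)
Lemma linear_matroid_split i (I : {set 'I_n.+1}) :
  (I \in M) = (I :&: column_fiber i \in M) && (I :\: column_fiber i \in M).
Proof.
set C := column_fiber i.
have closedC a j : G a j != 0 -> (b a \in C) = (j \in C).
  by move=> Gaj; rewrite !inE column_class_basis (column_class_inl Gaj).
apply/idP/andP => [MI|[/linear_matroidP MC /linear_matroidP MC']].
  by rewrite !(linear_matroidS _ MI) ?subsetIl ?subsetDl.
apply/linear_matroidP => y y0.
pose part (Q : pred 'I_n.+1) : 'rV_k := \row_a (if Q (b a) then y 0 a else 0).
have partE (Q : pred 'I_n.+1) j : (forall a, G a j != 0 -> Q (b a) = Q j) ->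
    (part Q *m G) 0 j = if Q j then (y *m G) 0 j else 0.
  move=> Qj; rewrite !mxE; case: ifP => Qj'; last first.
    apply: big1 => a _; rewrite mxE; have [->|/Qj->] := eqVneq (G a j) 0.
      by rewrite mulr0.
    by rewrite Qj' mul0r.
  apply: eq_bigr => a _; rewrite mxE; have [->|/Qj->] := eqVneq (G a j) 0.
    by rewrite !mulr0.
  by rewrite Qj'.
have y1 : part (mem C) = 0.
  apply: MC => j; rewrite partE /=; last by move=> a /closedC.
  by rewrite inE; case: ifP => // jC; rewrite andbT; apply: y0.
have y2 : part (mem (~: C)) = 0.
  apply: MC' => j; rewrite partE /=; last by move=> a /closedC; rewrite !in_setC => ->.
  by rewrite in_setC in_setD; case: ifP => //= _; apply: y0.
apply/rowP => a; move/rowP/(_ a): y1; move/rowP/(_ a): y2; rewrite !mxE /= in_setC.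
by case: (b a \in C) => /=.
Qed.

Lemma irreducible_sub_fiber (E : {set 'I_n.+1}) i :
  irreducible_set M E -> i \in E -> E \subset column_fiber i.
Proof.
move=> irrE iE; apply: contraR irrE => EC.
apply/existsP; exists (E :&: column_fiber i); apply/existsP.
exists (E :\: column_fiber i); apply/and5P; split.
- by apply/set0Pn; exists i; rewrite in_setI iE inE eqxx.
- by rewrite setD_eq0.
- by rewrite setID.
- by rewrite -setI_eq0 setDE setIACA setICr setI0.
- apply/forallP => I; apply/implyP => IE.
  by rewrite setIA setIDA (setIidPl IE) -linear_matroid_split.
Qed.

(* The complements of [b] and of the basis obtained from [b] by exchanging
   [b a] for [i] separate [E1] from [E2]. *)
Lemma crossing_edge (C E1 E2 : {set 'I_n.+1}) a i :
    (forall a' j, G a' j != 0 -> (b a' \in C) = (j \in C)) ->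
    E1 :|: E2 = C -> [disjoint E1 & E2] ->
    G a i != 0 -> b a \in E1 -> i \in E2 ->
  ~ (forall I : {set 'I_n.+1}, I \subset C ->
       (I \in M) = (I :&: E1 \in M) && (I :&: E2 \in M)).
Proof.
move=> closedC EC E12 Gai aE1 iE2 splitC; pose B := [set b a' | a' : 'I_k].
have iE1 : i \notin E1 by rewrite (disjointFl E12).
have aE2 : b a \notin E2 by rewrite (disjointFr E12).
(* The columns of [C] outside the basis, together with [b a]. This set is dependent, since row [a]
   of [G] vanishes outside it, but its traces on [E1] and [E2] are independent. *)
pose I := [set j in C | (j \notin B) || (j == b a)].
have IC : I \subset C by apply/subsetP => j; rewrite inE => /andP[].
have MI1 : I :&: E1 \in M.
  apply/linear_matroidP => y y0.
  have ya' a' : a' != a -> y 0 a' = 0.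
    move=> a'a; rewrite -mulmx_basis; apply: y0; rewrite !inE imset_f //=.
    rewrite (_ : b a' == b a = false) ?andbF //; apply: contraNF a'a => /eqP ba.
    have := Gb a a'; rewrite ba Gb eqxx.
    by case: eqP => [->|_ /eqP]; rewrite ?oner_eq0.
  have /eqP : (y *m G) 0 i = 0 by apply: y0; rewrite in_setI negb_and iE1 orbT.
  rewrite mxE (bigD1 a) //= big1 ?addr0 => [|a' /ya'->]; last by rewrite mul0r.
  rewrite mulf_eq0 (negPf Gai) orbF => /eqP ya.
  by apply/rowP => a'; rewrite mxE; have [->|/ya'] := eqVneq a' a.
have MI2 : I :&: E2 \in M.
  apply/linear_matroidP => y y0; apply/rowP => a'; rewrite -mulmx_basis [RHS]mxE.
  apply: y0; rewrite !inE imset_f //=; apply/negP => /andP[/andP[_ /eqP->]].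
  exact/negP.
have /linear_matroidP MI : I \in M by rewrite splitC // MI1.
suff y0 : delta_mx 0 a = 0 :> 'rV[F]_k.
  by move/rowP/(_ a): y0; rewrite !mxE !eqxx => /eqP; rewrite oner_eq0.
apply: MI => j; rewrite -rowE mxE inE negb_and.
have bC : b a \in C by rewrite -EC in_setU aE1.
case/orP => [jC|].
  by apply/eqP; apply: contraNT jC => /closedC <-.
rewrite negb_or negbK => /andP[/imsetP[a' _ ->]]; rewrite Gb.
by case: (a =P a') => [->|//]; rewrite eqxx.
Qed.

Lemma column_fiber_closed i a j :
  G a j != 0 -> (b a \in column_fiber i) = (j \in column_fiber i).
Proof. by move=> Gaj; rewrite !inE column_class_basis (column_class_inl Gaj). Qed.

(** By [crossing_edge] no edge joins the two parts of a splitting, so membership in [E1] is constant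
    on connected columns; but a fiber is connected or a single zero column. *)
Lemma irreducible_fiber i : irreducible_set M (column_fiber i).
Proof.
apply/negP => /existsP[E1 /existsP[E2]].
move=> /and5P[/set0Pn[x xE1] /set0Pn[y yE2] /eqP EC E12 /forallP splitC].
have {}splitC (I : {set 'I_n.+1}) : I \subset column_fiber i ->
    (I \in M) = (I :&: E1 \in M) && (I :&: E2 \in M).
  by move=> IC; have /implyP/(_ IC)/eqP := splitC I.
have no_edge a j : G a j != 0 -> (b a \in E1) = (j \in E1).
  move=> Gaj; have := column_fiber_closed i Gaj; rewrite -EC !inE.
  have [aE1|aE1] /= := boolP (b a \in E1); have [jE1|jE1] //= := boolP (j \in E1).
    move=> /esym jE2.
    by case: (crossing_edge (@column_fiber_closed i) EC E12 Gaj aE1 jE2 splitC).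
  move=> aE2; rewrite setUC in EC; rewrite disjoint_sym in E12.
  case: (crossing_edge (@column_fiber_closed i) EC E12 Gaj aE2 jE1) => I IC.
  by rewrite splitC // andbC.
have const a a' : rep a = rep a' -> (b a \in E1) = (b a' \in E1).
  move/eqP; rewrite root_connect; last exact: row_adj_connect_sym.
  apply: (connect_eq_fun (f := fun c => b c \in E1)).
  by move=> c c' /existsP[j /andP[/no_edge -> /no_edge ->]].
have xy : column_class x = column_class y.
  have /setP EC' := EC; move: (EC' x) (EC' y); rewrite !inE xE1 yE2 orbT.
  by move=> /esym/eqP-> /esym/eqP->.
have yE1 : y \notin E1 by rewrite (disjointFl E12).
have [[a Gax]|no_x] := pselect (exists a, G a x != 0).
  have [[a' Ga'y]|no_y] := pselect (exists a, G a y != 0).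
    move: xy; rewrite (column_class_inl Gax) (column_class_inl Ga'y) => -[/const].
    by rewrite (no_edge _ _ Gax) (no_edge _ _ Ga'y) xE1 (negPf yE1).
  move: xy; rewrite (column_class_inl Gax) column_class_inr // => a'.
  by apply/eqP; apply: contraT => Ga'; case: no_y; exists a'.
have x0 a : G a x = 0.
  by apply/eqP; apply: contraT => Ga; case: no_x; exists a.
move: xy; rewrite column_class_inr // /column_class; case: pickP => // _ [xy].
by rewrite -xy xE1 in yE1.
Qed.

Lemma components_column_fiber : components M = [set column_fiber i | i : 'I_n.+1].
Proof.
apply/setP => E; rewrite inE; apply/idP/imsetP => [/maxsetP[irrE maxE]|[i _ ->]].
  have [E0|[i iE]] := set_0Vmem E.
    (* The empty set is irreducible too, but the fiber of [ord0] properly contains it. *)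
    have := maxE _ (irreducible_fiber ord0); rewrite E0 sub0set => /(_ isT).
    by move/setP/(_ ord0); rewrite !inE eqxx.
  exists i => //; apply/esym/maxE; first exact: irreducible_fiber.
  exact: irreducible_sub_fiber.
apply/maxsetP; split=> [|E' irrE' subE]; first exact: irreducible_fiber.
apply/eqP; rewrite eqEsubset subE andbT; apply: irreducible_sub_fiber => //.
by apply: (subsetP subE); rewrite inE.
Qed.

(** If [G a i] is nonzero, exchanging [b a] for [i] gives a basis of columns containing [i]; its
    complement is independent and becomes dependent once [i] is added. *)
Lemma coloops_zero_column : coloops M = [set i | [forall a, G a i == 0]].
Proof.
apply/setP => i; rewrite !inE; apply/forallP/forallP => [coloop_i a|Gi0 I].
  apply: contraT => Gai; pose B := [set b a' | a' in [set~ a]].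
  have MI : ~: (i |: B) \in M.
    apply/linear_matroidP => y y0.
    have ya' a' : a' != a -> y 0 a' = 0.
      move=> a'a; rewrite -mulmx_basis; apply: y0.
      by rewrite in_setC negbK in_setU imset_f ?orbT // !inE.
    have /eqP : (y *m G) 0 i = 0 by apply: y0; rewrite in_setC negbK !inE eqxx.
    rewrite mxE (bigD1 a) //= big1 ?addr0 => [|a' /ya'->]; last by rewrite mul0r.
    rewrite mulf_eq0 (negPf Gai) orbF => /eqP ya.
    by apply/rowP => a'; rewrite mxE; have [->|/ya'] := eqVneq a' a.
  have /eqP := coloop_i (~: (i |: B)); rewrite MI => /esym/linear_matroidP MiI.
  suff y0 : delta_mx 0 a = 0 :> 'rV[F]_k.
    by move/rowP/(_ a): y0; rewrite !mxE !eqxx => /eqP; rewrite oner_eq0.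
  apply: MiI => j; rewrite -rowE mxE !inE negb_or negbK => /andP[/negPf->] /=.
  case/imsetP => a'; rewrite !inE => /negPf a'a ->.
  by rewrite Gb eq_sym a'a.
apply/eqP; apply/idP/idP; last exact/linear_matroidS/subsetUr.
move=> /linear_matroidP MI; apply/linear_matroidP => y y0; apply: MI => j jI.
have [->|ji] := eqVneq j i; last by apply: y0; rewrite !inE negb_or ji.
by rewrite mxE big1 // => a _; rewrite (eqP (Gi0 a)) mulr0.
Qed.

(** Fibers correspond to values of [column_class]: one [inr] for each zero column, and one [inl] for
    each class of rows, attained at some [b a]. *)
Lemma card_components :
  #|components M| = (#|coloops M| + #|[set rep a | a : 'I_k]|)%N.
Proof.
rewrite components_column_fiber coloops_zero_column.
have -> : [set column_fiber i | i : 'I_n.+1] =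
    [set [set j | column_class j == v] | v in [set column_class i | i : 'I_n.+1]].
  by rewrite -imset_comp.
rewrite card_in_imset => [|u v /imsetP[i _ ->] /imsetP[j _ ->] /setP/(_ i)]; last first.
  by rewrite !inE eqxx => /esym/eqP.
have -> : [set column_class i | i : 'I_n.+1] =
    (inr @: [set i | [forall a, G a i == 0]]) :|: (inl @: [set rep a | a : 'I_k]).
  apply/setP => v; rewrite in_setU; apply/imsetP/orP.
    move=> [i _ ->]; have [[a Gai]|no_a] := pselect (exists a, G a i != 0).
      by right; rewrite (column_class_inl Gai) !imset_f.
    have Gi a : G a i = 0.
      by apply/eqP; apply: contraT => Ga; case: no_a; exists a.
    left; rewrite column_class_inr // imset_f // inE.
    by apply/forallP => a; rewrite Gi.
  move=> [/imsetP[i + ->]|/imsetP[_ /imsetP[a _ ->] ->]].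
    rewrite inE => /forallP Gi; exists i => //.
    by rewrite column_class_inr // => a; apply/eqP.
  by exists (b a); rewrite // column_class_basis.
rewrite cardsU (_ : _ :&: _ = set0) ?cards0 ?subn0; last first.
  apply/setP => v; rewrite !inE; apply/negP => /andP[/imsetP[i _ ->] /imsetP[a _]].
  by [].
by rewrite (card_imset _ (@inr_inj _ _)) (card_imset _ (@inl_inj _ _)).
Qed.

End LinearSpace.

(** * The degree *)

Lemma vanishes_coord_power (F : numClosedFieldType) k n r d
    (W : {vspace 'rV[F]_n.+1}) (G : 'M[F]_(k.+1, n.+1)) (f : dhomog n.+1 F d) :
    (0 < r)%N -> (0 < \dim W)%N ->
    (forall x, x \in W <-> exists y, x = y *m G) ->
  vanishes f (coord_power r [set P | (sval P <= W)%VS]%classic) <->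
  forall y, (f : {mpoly F[n.+1]}).@[fun i => (\sum_a y a * G a i) ^+ r] = 0.
Proof.
move=> r_gt0 W_gt0 GW; split=> [fX y|f0 _ [Q QW <-] _ /vlineP[c ->]].
  have vanish x v : x \in W -> x != 0 -> v \in <[coord_pow r x]>%VS ->
      (f : {mpoly F[n.+1]}).@[v 0] = 0.
    move=> xW x0 v_in; apply: (fX (proj_point (coord_pow_neq0 r x0))) => //.
    by exists (proj_point x0); [rewrite /= -memvE | apply: pow_map_point].
  pose x := (\row_a y a) *m G.
  have xE i : x 0 i = \sum_a y a * G a i.
    by rewrite mxE; apply: eq_bigr => a _; rewrite mxE.
  have evalE (v : 'rV_n.+1) : v = coord_pow r x ->
      (f : {mpoly F[n.+1]}).@[fun i => (\sum_a y a * G a i) ^+ r] =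
      (f : {mpoly F[n.+1]}).@[v 0].
    by move=> ->; apply: meval_eq => i; rewrite mxE xE.
  have [x0|x0] := eqVneq x 0; last first.
    rewrite (evalE (coord_pow r x)) //; apply: (vanish x) => //; last exact: memv_line.
    by apply/GW; exists (\row_a y a).
  rewrite (evalE 0); last first.
    by rewrite x0; apply/rowP => i; rewrite !mxE expr0n gtn_eqF.
  (* The zero vector lies on every line, so any point of the image serves; one exists because [W] is
     nonzero. *)
  have W0 : vpick W != 0 by rewrite vpick0 -dimv_eq0 -lt0n.
  by apply: (vanish (vpick W)) => //; [apply: memv_pick | apply: mem0v].
have /GW[y yE] : homog_coords Q \in W by apply: (subvP QW); apply: memv_pick.
(* The scalar [c] is absorbed by rescaling [y] by an [r]-th root of it. *)
rewrite -(f0 (fun a => r.-root c * y 0 a)); apply: meval_eq => i.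
rewrite !mxE; under [in RHS]eq_bigr do rewrite -mulrA.
by rewrite -big_distrr /= exprMn rootCK // yE mxE.
Qed.

Theorem degree_coord_power (F : numClosedFieldType) (n k r : nat)
    (L : set (projspace F n)) (hr : (0 < r)%N) (hL : linear_space k L) :
  let s := #|coloops (linear_matroid L)| in
  let t := #|components (linear_matroid L)| in
  proj_degree (coord_power r L) = r%:R ^ (k%:Z + s%:Z - t%:Z + 1).
Proof.
have [W dimW ->] := hL; have [G [b [Gb GW]]] := reduced_basis dimW.
set X := coord_power r _; move=> s t.
pose c := #|[set row_rep G a | a : 'I_k.+1]|.
have tE : t = (s + c)%N by apply: card_components.
have le_c : (c <= k.+1)%N by rewrite -[k.+1]card_ord max_card.
(* Since [t = s + c], the exponent is [k + 1 - c], the number of non-representatives. *)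
have -> : k%:Z + s%:Z - t%:Z + 1 = #|nonrep G|%:Z.
  by rewrite card_nonrep -/c tE -subzn // PoszD; lia.
rewrite -exprnP -natrX; set N := (r ^ _)%N.
have fX d (f : dhomog n.+1 F d) : f \in vanishing_forms X d <->
    forall y, (f : {mpoly F[n.+1]}).@[fun i => (\sum_a y a * G a i) ^+ r] = 0.
  rewrite vanishing_formsP; apply: vanishes_coord_power => //.
  by rewrite dimW.
have [w w_prim] := closed_prim_root_exists F hr.
have HFlower e : (N * 'C(e + k, k) <= hilbert_fun X (e + N))%N.
  by apply: (codim_lower_bound hr Gb w_prim) => f /fX.
have HFupper d : (hilbert_fun X d <= N * 'C(d + k, k))%N.
  apply: (codim_upper_bound hr) => f f0; apply/fX => y.
  have := congr1 (meval y) f0; rewrite meval0 comp_mpoly_meval; apply: etrans.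
  apply: meval_eq => i.
  rewrite tnth_mktuple rmorphXn /= /column_form raddf_sum; congr (_ ^+ _).
  by apply: eq_bigr => a _; rewrite /= mevalZ mevalXU mulrC.
have N_gt0 : (0 < N)%N by rewrite expn_gt0 hr.
have [p [d0 pE]] := hilbert_fun_eventually_poly X.
(* The lower bound concerns degrees of the form [e + N], hence the threshold [N]. *)
have [d|size_p lc_p] := @rising_squeeze p k N (maxn d0 N) N_gt0.
  rewrite geq_max => /andP[d0d Nd]; rewrite -pE // !ler_nat HFupper andbT.
  by rewrite -{2}(subnK Nd) HFlower.
rewrite /proj_degree (hilbert_poly_unique pE) size_p lc_p mulrC divfK //.
by rewrite pnatr_eq0 -lt0n fact_gt0.
Qed.

Theorem theorem2p6 (R : realType) (n k r : nat) (L : set (projspace R[i] n))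
    (hr : (0 < r)%N) (hL : linear_space k L) :
  let s := #|coloops (linear_matroid L)| in
  let t := #|components (linear_matroid L)| in
  proj_degree (coord_power r L) = r%:R ^ (k%:Z + s%:Z - t%:Z + 1).
Proof. exact: degree_coord_power. Qed.
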